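(* Let $n\ge 4$ and let $\mathcal D_n$ be a minimal DFA with state set $Q_n=\{0,\dots,n-1\}$, initial state $0$ and unique final state $n-1$, recognizing a two-sided ideal, and let $T_n$ be its transition semigroup. If $|T_n|=n^{n-2}+(n-2)2^{n-2}+1$, then $T_n=S_n$.
   Context: A two-sided ideal is a nonempty $L\subseteq\Sigma^*$ with $L=\Sigma^*L\Sigma^*$. The transition semigroup of a DFA is the set of transformations $q\mapsto\delta(q,w)$ of its states induced by nonempty words $w$. Notation: $(p\to q)$ maps $p$ to $q$ and fixes all other states; $(p_0,\dots,p_{k-1})$ is the cyclic permutation $p_0\mapsto\cdots\mapsto p_{k-1}\mapsto p_0$ fixing all other states. $S_n$ (for $n\ge4$) is the transition semigroup of the DFA $\mathcal W_n$ with states $Q_n$, initial state $0$, final states $\{n-1\}$, alphabet $\{a,b,c,d,e,f\}$, where $a$ induces $(1,2,\dots,n-2)$, $b$ induces $(1,2)$, $c$ induces $(n-2\to 1)$, $d$ induces $(n-2\to 0)$, $e$ maps every state in $\{0,\dots,n-2\}$ to $1$ and fixes $n-1$, and $f$ induces $(1\to n-1)$. *)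

(* Defs.v *)
From mathcomp Require Import all_boot.
From mathcomp Require Import boolp.
Set Implicit Arguments. Unset Strict Implicit. Unset Printing Implicit Defensive.

(* A DFA with state set 'I_n = {0,...,n-1} over a finite alphabet Sigma is
   given by its letter action delta : Sigma -> transformation of 'I_n,
   an initial state and (here) a unique final state. *)
Section DFA.
Variables (Sigma : finType) (n : nat) (delta : Sigma -> {ffun 'I_n -> 'I_n}).

Definition run (q : 'I_n) (w : seq Sigma) : 'I_n :=
  foldl (fun p a => delta a p) q w.

Definition word_trans (w : seq Sigma) : {ffun 'I_n -> 'I_n} :=
  [ffun q => run q w].

Definition trans_semigroup : {set {ffun 'I_n -> 'I_n}} :=
  [set t | `[< exists w : seq Sigma, w <> [::] /\ word_trans w = t >]].

Definition accepts (i0 f : 'I_n) (w : seq Sigma) : Prop := run i0 w = f.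

Definition minimal_dfa (i0 f : 'I_n) : Prop :=
  (forall q : 'I_n, exists w : seq Sigma, run i0 w = q) /\
  (forall p q : 'I_n, p <> q ->
     exists w : seq Sigma, ~ (run p w = f <-> run q w = f)).
End DFA.

Definition two_sided_ideal (Sigma : Type) (L : seq Sigma -> Prop) : Prop :=
  (exists w, L w) /\
  (forall w, L w <-> exists u x v, L x /\ w = u ++ x ++ v).

(* transformation of 'I_n given by a nat function (which in all uses below
   maps {0..n-1} into itself) *)
Definition tr_of (n : nat) (g : nat -> nat) : {ffun 'I_n -> 'I_n} :=
  [ffun q => insubd q (g (val q))].

Definition W_a n := tr_of n (fun q =>
  if (1 <= q) && (q <= n - 3) then q.+1 else if q == n - 2 then 1 else q).
Definition W_b n := tr_of n (fun q => if q == 1 then 2 else if q == 2 then 1 else q).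
Definition W_c n := tr_of n (fun q => if q == n - 2 then 1 else q).
Definition W_d n := tr_of n (fun q => if q == n - 2 then 0 else q).
Definition W_e n := tr_of n (fun q => if q <= n - 2 then 1 else q).
Definition W_f n := tr_of n (fun q => if q == 1 then n - 1 else q).

Definition W_delta (n : nat) (x : 'I_6) : {ffun 'I_n -> 'I_n} :=
  match val x with
  | 0 => W_a n | 1 => W_b n | 2 => W_c n | 3 => W_d n | 4 => W_e n | _ => W_f n
  end.

Definition S_ (n : nat) : {set {ffun 'I_n -> 'I_n}} := trans_semigroup (W_delta n).

(* Main.v *)
From mathcomp Require Import all_boot all_fingroup zify.
From mathcomp Require Import boolp.
Require Import Defs.
Set Implicit Arguments. Unset Strict Implicit. Unset Printing Implicit Defensive.

(** Order the states by inclusion of their right languages.  For a minimal DFA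
    of a two-sided ideal this is a partial order with bottom [0] and top [n-1],
    every transformation of the semigroup is monotone, and it fixes [n-1].

    If two distinct states [a < b] other than [0] and [n-1] are comparable,
    write [u p] for the size of the up-set of [p].  A monotone map [t] sending
    [0] to [p] is given by a pair [t a <= t b] in the up-set of [p] and by
    [n-4] further values there, and listing the elements of an up-set from the
    top down yields at most [\sum_(1 <= u <= n) u^(n-4) * u (u+1) / 2] maps,
    which is less than [n^(n-2) + (n-2) 2^(n-2) + 1].

    Otherwise the order is flat, so either [t] fixes [0] or [t] maps every
    state to [t 0] or [n-1].  There are at most [n^(n-2) + (n-2) 2^(n-2) + 1]
    such maps fixing [n-1], and they are exactly the elements of [S_n]. *)

(** * Numerical estimates *)

Lemma leq_add_expn x k : x ^ k.+1 + k.+1 * x ^ k <= x.+1 ^ k.+1.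
Proof.
elim: k => [|k IH]; first by rewrite !expn1 expn0; lia.
move: IH; rewrite (expnS x.+1 k.+1) !(expnS x).
set X := x ^ k; set Y := x.+1 ^ _; nia.
Qed.

(** The first three terms of the binomial expansion of $(x+1)^{k+2}$, doubled to clear the
    denominator of the third coefficient. *)
Lemma leq_add_expn2 x k :
  2 * x ^ k.+2 + 2 * k.+2 * x ^ k.+1 + k.+2 * k.+1 * x ^ k <= 2 * x.+1 ^ k.+2.
Proof.
elim: k => [|k IH]; first by rewrite !expnS expn0; nia.
move: IH; rewrite (expnS x.+1 k.+2) !(expnS x).
set X := x ^ k; set Y := x.+1 ^ _; nia.
Qed.

(** Three binomial terms suffice: $1+\frac{k-3}{k}+\frac{(k-3)(k-4)}{2k^2}$ equals $2$ at $k=12$ and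
    increases from there on. *)
Lemma double_expn_leq k : 12 <= k -> 2 * k ^ (k - 3) <= k.+1 ^ (k - 3).
Proof.
move=> hk; have [j ->] : exists j, k = j + 12 by exists (k - 12); lia.
have -> : j + 12 - 3 = (j + 7).+2 by lia.
have := leq_add_expn2 (j + 12) (j + 7); rewrite !(expnS (j + 12)).
set X := (j + 12) ^ _; set Y := (j + 12).+1 ^ _; nia.
Qed.

(** By Bernoulli's inequality the terms $u^k(u+1)$ at least double from $u$ to $u+1$ as long as
    $u\le k+1$, so the last term dominates the others. *)
Lemma sum_expn_leq k N : 0 < k -> N <= k.+1 ->
  \sum_(1 <= u < N.+2) u ^ k * u.+1 <= 2 * (N.+1 ^ k * N.+2).
Proof.
move=> hk; elim: N => [|N IH] hN; first by rewrite big_nat1; lia.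
rewrite big_nat_recr //=; apply: leq_trans (leq_add (IH _) (leqnn _)) _; first by lia.
have := leq_add_expn N.+1 k.-1; rewrite (prednK hk).
have -> : N.+1 ^ k = N.+1 * N.+1 ^ k.-1 by rewrite -expnS prednK.
set X := N.+1 ^ _; set Y := N.+2 ^ _ => h.
suff : 2 * (N.+1 * X * N.+2) <= (N.+1 * X + k * X) * N.+3 by nia.
have : 2 * (N.+1 * N.+2) <= (N.+1 + k) * N.+3 by nia.
nia.
Qed.

(** Both sides are doubled to clear the halves in $u(u+1)/2$. For $n\ge13$ the terms with $u<n$
    contribute at most $2n(n-1)^{n-3}\le(n-1)n^{n-3}$; with the last term $(n+1)n^{n-3}$ this makes
    $2n^{n-2}$. *)
Lemma sum_expn_ltn n : 4 <= n ->
  \sum_(1 <= u < n.+1) u ^ (n - 4) * (u * u.+1)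
  < 2 * (n ^ (n - 2) + (n - 2) * 2 ^ (n - 2) + 1).
Proof.
move=> hn; have [hn13|hn13] := leqP 13 n; last first.
  have : n \in iota 4 9 by rewrite mem_iota; lia.
  rewrite !inE; do ?case/orP; move/eqP=> ->; 
    rewrite /index_iota /= !big_cons big_nil !subSS !subn0; lia.
have e u : u ^ (n - 4) * (u * u.+1) = u ^ (n - 3) * u.+1.
  by rewrite mulnA -expnSr; congr (_ ^ _ * _); lia.
under eq_bigr do rewrite e.
have [m En] : exists m, n = m.+2 by exists (n - 2); lia.
rewrite big_nat_recr /=; last by lia.
have : \sum_(1 <= u < n) u ^ (n - 3) * u.+1 <= 2 * (n.-1 ^ (n - 3) * n).
  by rewrite En; apply: sum_expn_leq; lia.
have n1 : n.-1.+1 = n by lia.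
have := @double_expn_leq n.-1; rewrite n1.
have -> : n.-1 - 3 = n - 4 by lia.
have [j Ej] : exists j, n - 4 = j by exists (n - 4).
have -> : n - 3 = j.+1 by lia.
have -> : n - 2 = j.+2 by lia.
rewrite Ej !(expnS n) (expnS n.-1).
set X := n ^ j; set Y := n.-1 ^ j; set Z := \sum_(_ <= _ < _) _.
move=> /(_ ltac:(lia)) h1 h2.
have : 2 * (n.-1 * Y * n) <= n.-1 * n * X by nia.
rewrite -n1 /=; nia.
Qed.

(** * Counting transformations with prescribed values *)

Section TransformationCounting.
Variables (T : finType).
Implicit Types (U D : {set T}) (h : T -> T).

Lemma card_maps_fixed_on D h U :
  #|[set t : {ffun T -> T} |
      [forall q in D, t q == h q] && [forall q, t q \in U]]|
  <= #|U| ^ (#|T| - #|D|).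
Proof.
pose F (q : T) : pred T := if q \in D then pred1 (h q) else mem U.
apply: (@leq_trans #|(family F : pred {ffun T -> T})|).
  apply/subset_leq_card/subsetP=> t; rewrite inE => /andP[/forall_inP tD /forallP tU].
  apply/familyP=> q; rewrite /F; case: ifP => [/tD //|_]; exact: tU.
rewrite card_family foldrE big_map big_enum /= (bigID (mem D)) /=.
rewrite big1 ?mul1n => [|q qD]; last by rewrite /F qD card1.
rewrite (eq_bigr (fun=> #|U|)) => [|q /negbTE qD]; last by rewrite /F qD.
rewrite prod_nat_const -(cardC D) addKn.
by [].
Qed.

End TransformationCounting.

(** * Up-sets and monotone maps of a finite poset *)

Section Poset.
Variables (T : finType) (le : rel T).
Hypotheses (le_refl : reflexive le) (le_anti : antisymmetric le).
Hypothesis (le_trans : transitive le).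

Definition up (p : T) : {set T} := [set q | le p q].

(* Removing an element [p] of [A] with the largest up-set leaves an up-closed
   set, and the up-set of [p] has at most [#|A|] elements. *)
Lemma sum_card_up (A : {set T}) (G : nat -> nat) :
  {homo G : u v / u <= v} -> (forall p, p \in A -> up p \subset A) ->
  \sum_(p in A) G #|up p| <= \sum_(1 <= u < #|A|.+1) G u.
Proof.
move=> Gmono; elim: {A}_.+1 {-2}A (ltnSn #|A|) => // k IH A ltAk Aup.
have [->|[x0 x0A]] := set_0Vmem A; first by rewrite big_set0.
pose p := [arg max_(q > x0 in A) #|up q|].
have [pA pmax] : p \in A /\ forall q, q \in A -> #|up q| <= #|up p|.
  by rewrite /p; case: arg_maxnP.
have cA : #|A| = #|A :\ p|.+1 by rewrite (cardsD1 p) pA.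
rewrite (big_setD1 p) //= cA big_nat_recr //= addnC; apply: leq_add.
  apply: IH => [|q]; first by rewrite -ltnS -cA.
  rewrite in_setD1 => /andP[qp qA]; apply/subsetP=> x qx; rewrite in_setD1.
  rewrite (subsetP (Aup q qA)) // andbT; apply: contraNneq qp => xp.
  move: qx; rewrite inE xp => qp.
  have sub : up p \subset up q.
    by apply/subsetP=> y; rewrite !inE; exact: le_trans.
  have /eqP E : up p == up q by rewrite eqEcard sub pmax.
  apply/eqP/le_anti; rewrite qp /=.
  by have : q \in up q; [rewrite inE | rewrite -E inE].
by apply/Gmono; rewrite -cA; apply/subset_leq_card/Aup.
Qed.

(** The sum counts the pairs $x\le y$ above $p$, that is, the possible values at $a\le b$ of a
    monotone map sending the bottom to $p$. *)
Lemma sum_up_card_up p : 2 * (\sum_(x in up p) #|up x|) <= #|up p| * #|up p|.+1.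
Proof.
have up_up x : x \in up p -> up x \subset up p.
  by rewrite inE => px; apply/subsetP=> y; rewrite !inE; exact: le_trans.
have := @sum_card_up (up p) id (fun _ _ => id) up_up.
have -> : \sum_(1 <= u < #|up p|.+1) u = 'C(#|up p|.+1, 2).
  by rewrite -bin2_sum [RHS]big_ltn.
rewrite -(leq_pmul2l (isT : 0 < 2)) => /leq_trans; apply.
by rewrite bin2 /= [X in X./2]mulnC; set x := (_ * _.+1); lia.
Qed.

Lemma card_monotone_leq (M : {set {ffun T -> T}}) (bot top a b : T) :
  (forall p, le bot p) -> (forall t, t \in M -> t top = top) ->
  (forall t, t \in M -> {homo t : p q / le p q}) ->
  le a b -> #|[set bot; top; a; b]| = 4 ->
  2 * #|M| <= \sum_(1 <= u < #|T|.+1) u ^ (#|T| - 4) * (u * u.+1).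
Proof.
move=> bot_le Mtop Mmono ab card4.
(* Maps are grouped by their values at [bot], [a] and [b]. As [top] is fixed, each group leaves
   $|T|-4$ values free in the up-set of the value at [bot]. *)
pose key (t : {ffun T -> T}) := (t bot, t a, t b).
pose Q (k : T * T * T) := (k.1.2 \in up k.1.1) && (k.2 \in up k.1.2).
have keyQ t : t \in M -> Q (key t).
  by move=> tM; rewrite /Q /= !inE !(Mmono _ tM).
have cardM : #|M| <= \sum_(k | Q k) #|up k.1.1| ^ (#|T| - 4).
  rewrite -sum1_card (partition_big key Q) //; apply: leq_sum => -[[p x] y] _ /=.
  rewrite sum1_card.
  (* Only the four distinguished points are constrained, so the default branch is read at [top]
     alone. *)
  pose h q := if q == bot then p else if q == a then x else if q == b then y else top.
  rewrite -card4; apply: leq_trans (card_maps_fixed_on _ h _).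
  apply/subset_leq_card/subsetP=> t; rewrite !inE => /andP[tM /eqP[tp tx ty]].
  apply/andP; split; last by apply/forallP=> q; rewrite inE -tp; apply: Mmono.
  apply/forall_inP=> q; rewrite !inE /h.
  case: (eqVneq q bot) => [->|_ /=]; first by rewrite tp.
  case: (eqVneq q a) => [->|_]; first by rewrite tx.
  case: (eqVneq q b) => [->|_]; first by rewrite ty.
  by rewrite !orbF => /eqP->; rewrite Mtop.
apply: leq_trans (_ : \sum_(p in [set: T])
  #|up p| ^ (#|T| - 4) * (#|up p| * #|up p|.+1) <= _).
  apply: leq_trans (leq_mul (leqnn 2) cardM) _.
  (* The sum over triples is unfolded into nested sums over $p$, $x\ge p$ and $y\ge x$, the inner
     two being bounded by [sum_up_card_up]. *)
  rewrite -(pair_big_dep (fun k : T * T => k.2 \in up k.1)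
     (fun k y => y \in up k.2) (fun k _ => #|up k.1| ^ (#|T| - 4))) /=.
  rewrite -(pair_big_dep xpredT (fun p x => x \in up p)
     (fun p x => \sum_(y in up x) #|up p| ^ (#|T| - 4))) /=.
  rewrite big_distrr /= big_mkcond [leqRHS]big_mkcond /=; apply: leq_sum => p _.
  rewrite inE; under eq_bigr do rewrite sum_nat_const mulnC.
  by rewrite -big_distrr /= mulnCA leq_mul // sum_up_card_up.
rewrite -cardsT; apply: (sum_card_up (G := fun u => u ^ _ * (u * u.+1))) => [u v uv|p _].
  by rewrite !leq_mul //; case: (_ - 4) => // e; rewrite leq_exp2r.
exact: subsetT.
Qed.

End Poset.

(** * Composition in transition semigroups *)

Ltac iflia := do ?[case: ifP => ?]; lia.

Lemma mem_ext_tr (T : finType) (A : {set {ffun T -> T}}) (s t : {ffun T -> T}) :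
  s \in A -> s =1 t -> t \in A.
Proof. by move=> sA /ffunP<-. Qed.

Definition comp_tr (T : finType) (s t : {ffun T -> T}) : {ffun T -> T} :=
  [ffun q => t (s q)].

Lemma comp_trE (T : finType) (s t : {ffun T -> T}) q : comp_tr s t q = t (s q).
Proof. by rewrite ffunE. Qed.

Section TransitionSemigroup.
Variables (Sigma : finType) (n : nat) (delta : Sigma -> {ffun 'I_n -> 'I_n}).

Lemma run_cat q u v : run delta q (u ++ v) = run delta (run delta q u) v.
Proof. exact: foldl_cat. Qed.

Lemma trans_semigroupP t :
  reflect (exists w, w <> [::] /\ word_trans delta w = t)
          (t \in trans_semigroup delta).
Proof. by rewrite inE; exact: asboolP. Qed.

Lemma trans_semigroup_comp s t :
  s \in trans_semigroup delta -> t \in trans_semigroup delta ->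
  comp_tr s t \in trans_semigroup delta.
Proof.
move=> /trans_semigroupP[u [u0 <-]] /trans_semigroupP[v [v0 <-]].
apply/trans_semigroupP; exists (u ++ v); split; first by case: u u0.
by apply/ffunP=> q; rewrite !ffunE run_cat.
Qed.

Lemma trans_semigroup_letter x : delta x \in trans_semigroup delta.
Proof.
apply/trans_semigroupP; exists [:: x]; split=> //.
by apply/ffunP=> q; rewrite ffunE.
Qed.

End TransitionSemigroup.

(** * Generation of the flat transformations by the letters of $\mathcal W_n$ *)

Lemma tr_ofE n (g : nat -> nat) (q : 'I_n) : g q < n -> tr_of n g q = g q :> nat.
Proof. by move=> h; rewrite ffunE val_insubd h. Qed.

Definition perm_tr (T : finType) (s : {perm T}) : {ffun T -> T} := [ffun q => s q].

Definition move_tr (T : finType) (i j : T) : {ffun T -> T} :=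
  [ffun q => if q == i then j else q].

Section WitnessSemigroup.
Variables (n : nat) (z f : 'I_n).
Hypotheses (n4 : 4 <= n) (zE : z = 0 :> nat) (fE : f = n - 1 :> nat).

Local Notation "x \inS" := (x \in S_ n) (at level 70).
Local Notation mid q := (0 < nat_of_ord q < n - 1).

Lemma ord_mk k : k < n -> exists q : 'I_n, q = k :> nat.
Proof. by move=> h; exists (Ordinal h). Qed.

Lemma midE (q : 'I_n) : mid q = (q != z) && (q != f).
Proof. by rewrite -!val_eqE /= zE fE; have := ltn_ord q; lia. Qed.

Lemma zNf : z != f. Proof. by rewrite -val_eqE /= zE fE; lia. Qed.

Lemma W_in (k : nat) (h : k < 6) : W_delta n (Ordinal h) \inS.
Proof. exact: trans_semigroup_letter. Qed.

Lemma W_a_in : W_a n \inS. Proof. exact: (@W_in 0). Qed.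
Lemma W_b_in : W_b n \inS. Proof. exact: (@W_in 1). Qed.
Lemma W_c_in : W_c n \inS. Proof. exact: (@W_in 2). Qed.
Lemma W_d_in : W_d n \inS. Proof. exact: (@W_in 3). Qed.
Lemma W_e_in : W_e n \inS. Proof. exact: (@W_in 4). Qed.
Lemma W_f_in : W_f n \inS. Proof. exact: (@W_in 5). Qed.

Lemma W_aE (q : 'I_n) : W_a n q = (if (1 <= q) && (q <= n - 3) then q.+1
  else if q == n - 2 :> nat then 1 else q) :> nat.
Proof. by rewrite tr_ofE //; have := ltn_ord q; iflia. Qed.
Lemma W_bE (q : 'I_n) : W_b n q =
  (if q == 1 :> nat then 2 else if q == 2 :> nat then 1 else q) :> nat.
Proof. by rewrite tr_ofE //; have := ltn_ord q; iflia. Qed.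
Lemma W_cE (q : 'I_n) : W_c n q = (if q == n - 2 :> nat then 1 else q) :> nat.
Proof. by rewrite tr_ofE //; have := ltn_ord q; iflia. Qed.
Lemma W_dE (q : 'I_n) : W_d n q = (if q == n - 2 :> nat then 0 else q) :> nat.
Proof. by rewrite tr_ofE //; have := ltn_ord q; iflia. Qed.
Lemma W_eE (q : 'I_n) : W_e n q = (if q <= n - 2 then 1 else q) :> nat.
Proof. by rewrite tr_ofE //; have := ltn_ord q; iflia. Qed.
Lemma W_fE (q : 'I_n) : W_f n q = (if q == 1 :> nat then n - 1 else q) :> nat.
Proof. by rewrite tr_ofE //; have := ltn_ord q; iflia. Qed.

Lemma perm_trM (s t : {perm 'I_n}) :
  perm_tr s \inS -> perm_tr t \inS -> perm_tr (s * t)%g \inS.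
Proof.
move=> sS tS; apply: (mem_ext_tr (trans_semigroup_comp sS tS)) => q.
by rewrite !ffunE permM.
Qed.

Lemma perm_trX (s : {perm 'I_n}) k : perm_tr s \inS -> perm_tr (s ^+ k.+1)%g \inS.
Proof. by move=> sS; elim: k => // k IH; rewrite expgS; exact: perm_trM. Qed.

Lemma perm_trV (s : {perm 'I_n}) : perm_tr s \inS -> perm_tr s^-1%g \inS.
Proof.
move=> sS; have o0 : 0 < #[s]%g := order_gt0 s; set m := #[s]%g in o0.
(* The inverse is taken as $s^{2m-1}$ rather than $s^{m-1}$, so that the exponent stays positive
   when $m=1$: the empty word is excluded. *)
have := perm_trX (m + m - 2) sS.
suff -> : (s ^+ (m + m - 2).+1 = s^-1)%g by [].
apply/eqP; rewrite eq_sym eq_invg_mul -expgS.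
by rewrite (_ : _.+2 = m + m); [rewrite expgD expg_order mulg1 | lia].
Qed.

Lemma perm_trJ (s t : {perm 'I_n}) :
  perm_tr s \inS -> perm_tr t \inS -> perm_tr (s ^ t)%g \inS.
Proof. by move=> sS tS; rewrite /conjg; do !apply: perm_trM => //; exact: perm_trV. Qed.

Lemma W_a_inj : injective (W_a n).
Proof.
move=> p q /(congr1 val) /=; rewrite !W_aE => h; apply: val_inj => /=; move: h.
by have := ltn_ord p; have := ltn_ord q; iflia.
Qed.

Definition a_perm : {perm 'I_n} := perm W_a_inj.

Lemma a_perm_in : perm_tr a_perm \inS.
Proof. by apply: (mem_ext_tr (W_a_in)) => q; rewrite [RHS]ffunE permE. Qed.

(** Conjugating by the cycle $a$ shifts an adjacent transposition by one, starting from
    $b=(1,2)$. *)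
Lemma tperm_adj_in (i j : 'I_n) :
  0 < i -> j < n - 1 -> j = i.+1 :> nat -> perm_tr (tperm i j) \inS.
Proof.
case: i => i; elim: i j => [//|i IH] j ltin /= _ ltj ji.
have [i0|i0] := posnP i.
  apply: (mem_ext_tr (W_b_in)) => q; apply: val_inj.
  rewrite /= W_bE ffunE permE /= -!val_eqE /= ji.
  by do !case: ifP => //=; rewrite ?ji; lia.
have [j' jE] : exists q : 'I_n, q = i.+1 :> nat by apply: ord_mk; lia.
have ltin' : i < n by lia.
have := perm_trJ (IH j' ltin' i0 _ jE) a_perm_in; rewrite tpermJ jE => /(_ ltac:(lia)).
suff [-> ->] : a_perm (Ordinal ltin') = Ordinal ltin /\ a_perm j' = j by [].
by split; apply: val_inj; rewrite /= permE W_aE /= ?jE; iflia.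
Qed.

Lemma tperm_in (i j : 'I_n) : mid i -> mid j -> i != j -> perm_tr (tperm i j) \inS.
Proof.
wlog ltij : i j / i < j => [hw mi mj ij|].
  have [h|h] := ltnP i j; first exact: hw.
  rewrite tpermC; apply: hw => //; last by rewrite eq_sym.
  by move: ij; rewrite -val_eqE /=; lia.
move=> mi mj _; have [d jE] : exists d, j = i + d.+1 :> nat by exists (j - i.+1); lia.
elim: d j {ltij} mj jE => [|d IH] j mj jE; first by apply: tperm_adj_in; lia.
have [j' jE'] : exists q : 'I_n, q = i + d.+1 :> nat.
  by apply: ord_mk; have := ltn_ord j; lia.
have a1 : perm_tr (tperm j' j) \inS by apply: tperm_adj_in; lia.
have := perm_trJ (IH j' ltac:(lia) jE') a1; rewrite tpermJ tpermL tpermD //.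
  by rewrite -val_eqE /=; lia.
by rewrite -val_eqE /=; lia.
Qed.

(** Composing with the transposition of [i] and [s i] makes a moved point [i] fixed and moves no new
    point. *)
Lemma perm_in (s : {perm 'I_n}) : s z = z -> s f = f -> perm_tr s \inS.
Proof.
elim: {s}_.+1 {-2}s (ltnSn #|[set x | s x != x]|) => // k IH s ltk sz sf.
have [E|[i]] := set_0Vmem [set x | s x != x].
  (* The identity also needs a nonempty word, obtained here as $a\,a^{-1}$. *)
  have -> : s = (a_perm * a_perm^-1)%g.
    rewrite mulgV; apply/permP=> x; rewrite perm1.
    by have /setP/(_ x) := E; rewrite !inE => /negbFE/eqP.
  by apply: perm_trM (perm_trV _); exact: a_perm_in.
rewrite inE => si; pose s' := (s * tperm i (s i))%g.
have siz : (i != z) && (i != f).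
  by apply/andP; split; apply: contraNneq si => ->; rewrite ?sz ?sf.
have ssiz : (s i != z) && (s i != f).
  by rewrite -{1}sz -{1}sf !(inj_eq perm_inj).
have -> : s = (s' * tperm i (s i))%g by rewrite -mulgA tperm2 mulg1.
case/andP: (siz) => iz if_; case/andP: (ssiz) => siz' sif'.
apply: perm_trM; last by apply: tperm_in; rewrite ?midE // eq_sym.
apply: IH; [|by rewrite permM sz tpermD|by rewrite permM sf tpermD].
rewrite -ltnS; apply: leq_trans ltk; rewrite ltnS.
apply/proper_card/properP; split; last first.
  by exists i; rewrite !inE // permM tpermR eqxx.
apply/subsetP=> x; rewrite !inE permM; apply: contraNneq => sx.
have [xi|xi] := eqVneq x i; first by rewrite xi tpermR.
rewrite sx tpermD // 1?eq_sym //.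
by apply: contraNneq xi => E; rewrite -(inj_eq (@perm_inj _ s)) sx E.
Qed.

Lemma move_trJ (s : {perm 'I_n}) i j : perm_tr s \inS -> move_tr i j \inS ->
  move_tr (s i) (s j) \inS.
Proof.
move=> sS mS.
apply: (mem_ext_tr (trans_semigroup_comp (perm_trV sS)
  (trans_semigroup_comp mS sS))) => q; rewrite !ffunE.
have [->|qi] := eqVneq q (s i); first by rewrite permK eqxx.
by case: eqP => [E|_]; [rewrite -E permKV eqxx in qi | rewrite permKV].
Qed.

(** The letters $d$, $f$ and $c$ give one move each with target $0$, $n-1$ and a middle state;
    conjugation by permutations fixing $0$ and $n-1$ yields all others. *)
Lemma move_in (i j : 'I_n) : mid i -> i != j -> move_tr i j \inS.
Proof.
have [o oE] := @ord_mk 1 ltac:(lia).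
have [l lE] := @ord_mk (n - 2) ltac:(lia).
have c_in : move_tr l o \inS.
  apply: (mem_ext_tr (W_c_in)) => q; apply: val_inj.
  by rewrite /= W_cE ffunE -val_eqE /= lE; case: ifP.
have d_in : move_tr l z \inS.
  apply: (mem_ext_tr (W_d_in)) => q; apply: val_inj.
  by rewrite /= W_dE ffunE -val_eqE /= lE; case: ifP.
have f_in : move_tr o f \inS.
  apply: (mem_ext_tr (W_f_in)) => q; apply: val_inj.
  by rewrite /= W_fE ffunE -val_eqE /= oE; case: ifP.
have ml : mid l by lia.
have mo : mid o by lia.
have lo : l != o by rewrite -val_eqE /=; lia.
have fix_in x y : mid x -> mid y ->
    [/\ tperm x y z = z, tperm x y f = f & perm_tr (tperm x y) \inS].
  rewrite !midE => /andP[xz xf] /andP[yz yf].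
  have E1 : tperm x y z = z by rewrite tpermD.
  have E2 : tperm x y f = f by rewrite tpermD.
  by split=> //; exact: perm_in.
move=> mi ij; have [jz|jz] := eqVneq j z.
  have [Ez _ Ein] := fix_in _ _ ml mi.
  by have := move_trJ Ein d_in; rewrite tpermL Ez jz.
have [jf|jf] := eqVneq j f.
  have [_ Ef Ein] := fix_in _ _ mo mi.
  by have := move_trJ Ein f_in; rewrite tpermL Ef jf.
have [Ez Ef Ein] := fix_in _ _ ml mi.
have mj : mid j by rewrite midE jz.
have mx : mid (tperm l i o).
  move: mo; rewrite !midE -{2}Ez -{2}Ef !(inj_eq perm_inj) //.
have xi : tperm l i o != i.
  by rewrite -[X in _ != X](tpermL l i) (inj_eq perm_inj) eq_sym.
have [_ _ Ein2] := fix_in _ _ mx mj.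
(* The first conjugation brings the source to [i] and the target to [tperm l i o]; the second fixes
   [i] and carries that target to [j]. *)
have := move_trJ Ein2 (move_trJ Ein c_in).
by rewrite !tpermL (tpermD xi) // eq_sym.
Qed.

(* If [t i = t j] with [i <> j], then [t] is the move [i -> j] followed by [t]
   with the value at [i] replaced by any state missing from the image; this
   enlarges the image until [t] is a permutation. *)
Lemma fix_z_f_in (t : {ffun 'I_n -> 'I_n}) : t z = z -> t f = f -> t \inS.
Proof.
elim: {t}_.+1 {-2}t (ltnSn #|~: (t @: setT)|) => // k IH t ltk tz tf.
have [tinj|] := boolP (injectiveb t).
  have := @perm_in (perm (injectiveP _ tinj)); rewrite !permE => /(_ tz tf).
  by move/mem_ext_tr; apply=> q; rewrite ffunE permE.
move=> tninj; have [E|[m]] := set_0Vmem (~: (t @: setT)).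
  case/injectiveP: tninj => x y; apply: (imset_injP (D := setT)) => //.
  by rewrite -(setCK (t @: setT)) E setC0.
rewrite inE => mt.
(* Two states with a common image cannot be [z] and [f], which are fixed and distinct, so one of
   them is a middle state. *)
have [i [j [mi ij tij]]] : exists i j, [/\ mid i, i != j & t i = t j].
  have /injectivePn[x [y xy txy]] := tninj.
  have [mx|] := boolP (mid x); first by exists x, y.
  have [my|] := boolP (mid y); first by exists y, x; rewrite eq_sym.
  rewrite !midE !negb_and !negbK => /orP[]/eqP ey /orP[]/eqP ex; subst x y;
    by move: xy; rewrite ?eqxx //; move: txy (zNf); rewrite tz tf => ->; rewrite eqxx.
pose t' : {ffun 'I_n -> 'I_n} := [ffun q => if q == i then m else t q].
have /andP[iz if_] : (i != z) && (i != f) by rewrite -midE.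
have -> : t = comp_tr (move_tr i j) t'.
  apply/ffunP=> q; rewrite !ffunE; case: (eqVneq q i) => [->|/negbTE->] //.
  by rewrite eq_sym (negbTE ij).
apply: trans_semigroup_comp; first exact: move_in.
apply: IH; [|by rewrite ffunE eq_sym (negbTE iz)|by rewrite ffunE eq_sym (negbTE if_)].
rewrite -ltnS; apply: leq_trans ltk; rewrite ltnS.
apply/proper_card/properP; split; last first.
  exists m; rewrite !inE // negbK; apply/imsetP; exists i => //.
  by rewrite ffunE eqxx.
apply/subsetP=> x; rewrite !inE; apply: contraNN => /imsetP[q _ ->].
have [->|qi] := eqVneq q i.
  by apply/imsetP; exists j => //; rewrite ffunE eq_sym (negbTE ij).
by apply/imsetP; exists q => //; rewrite ffunE (negbTE qi).
Qed.

(* The maps fixing [n-1] that are monotone for the order in which distinct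
   states other than [0] and [n-1] are incomparable. *)
Definition flat_tr (t : {ffun 'I_n -> 'I_n}) : bool :=
  (t f == f) && [forall q, t q \in if t z == z then setT else [set t z; f]].

Lemma flat_trP (t : {ffun 'I_n -> 'I_n}) :
  reflect (t f = f /\ (t z = z \/ forall q, t q = t z \/ t q = f)) (flat_tr t).
Proof.
apply: (iffP andP) => -[/eqP tf]; rewrite ?tf => h; split=> //.
  move/forallP: h => h; have [|tz] := eqVneq (t z) z; [by left|right=> q].
  by have := h q; rewrite (negbTE tz) !inE => /orP[]/eqP; [left|right].
apply/forallP=> q; case: eqP => [|tz]; first by rewrite inE.
by case: h => // /(_ q) []->; rewrite !inE eqxx ?orbT.
Qed.

Lemma flat_tr_comp s t : flat_tr s -> flat_tr t -> flat_tr (comp_tr s t).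
Proof.
move=> /flat_trP[sf hs] /flat_trP[tf ht]; apply/flat_trP; rewrite !ffunE sf; split=> //.
case: hs => [->|hs]; first by case: ht => [->|ht]; [left|right=> q; rewrite !ffunE].
by right=> q; rewrite !ffunE; case: (hs q) => ->; [left|right].
Qed.

Lemma W_flat x : flat_tr (W_delta n x).
Proof.
have eqz (q : 'I_n) : q = 0 :> nat -> q = z.
  by move=> h; apply: val_inj; rewrite /= zE.
have eqf (q : 'I_n) : q = n - 1 :> nat -> q = f.
  by move=> h; apply: val_inj; rewrite /= fE.
have [o oE] := @ord_mk 1 ltac:(lia).
apply/flat_trP; rewrite /W_delta; case: x => -[|[|[|[|[|x]]]]] ? /=.
all: try by split; [apply: eqf | left; apply: eqz];
  rewrite /= ?W_aE ?W_bE ?W_cE ?W_dE ?W_fE /= ?fE ?zE /=; iflia.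
split; first by apply: eqf; rewrite /= W_eE fE; iflia.
right=> q; have [h|h] := leqP q (n - 2).
  by left; apply: val_inj; rewrite /= !W_eE h zE.
by right; apply: eqf; rewrite /= W_eE; have := ltn_ord q; iflia.
Qed.

Lemma witness_semigroupE : S_ n = [set t | flat_tr t].
Proof.
apply/setP=> t; rewrite [RHS]inE; apply/idP/idP.
  case/trans_semigroupP=> w [_ <-]; elim: w => [|x w IH].
    by apply/flat_trP; split; [|left]; rewrite ffunE.
  have -> : word_trans (W_delta n) (x :: w)
            = comp_tr (W_delta n x) (word_trans (W_delta n) w).
    by apply/ffunP=> q; rewrite !ffunE.
  exact: flat_tr_comp (W_flat x) IH.
case/flat_trP=> tf ht; have [tz|tz] := eqVneq (t z) z; first exact: fix_z_f_in.
case: ht => [h|ht]; first by rewrite h eqxx in tz.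
have [o oE] := @ord_mk 1 ltac:(lia).
have oz : o != z by rewrite -val_eqE /= oE zE.
have of_ : o != f by rewrite -val_eqE /= oE fE; lia.
(* A flat map not fixing [z] factors through $e$: [r] first sends to [f] every state that [t] sends
   there, $e$ collapses the rest to state $1$, and [s] sends $1$ to [t z]. Both [r] and [s] fix [z]
   and [f]. *)
pose r : {ffun 'I_n -> 'I_n} :=
  [ffun q => if q == z then z else if t q == f then f else q].
pose s : {ffun 'I_n -> 'I_n} := [ffun q => if q == o then t z else q].
have eE q : W_e n q = if q == f then f else o.
  apply: val_inj; rewrite /= W_eE (fun_if val) -val_eqE /= fE oE.
  by have := ltn_ord q; iflia.
have -> : t = comp_tr r (comp_tr (W_e n) s).
  apply/ffunP=> q; rewrite !comp_trE eE !ffunE; have [->|qz] := eqVneq q z.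
    by rewrite (negbTE zNf) eqxx.
  have [tqf|tqf] := eqVneq (t q) f; first by rewrite eqxx eq_sym (negbTE of_) tqf.
  have qf : q != f by apply: contraNneq tqf => ->; rewrite tf.
  by rewrite (negbTE qf) eqxx; case: (ht q) => // E; rewrite E eqxx in tqf.
apply: trans_semigroup_comp.
  by apply: fix_z_f_in; rewrite !ffunE ?eqxx // eq_sym (negbTE zNf) tf eqxx.
apply: trans_semigroup_comp; first exact: W_e_in.
by apply: fix_z_f_in; rewrite ffunE eq_sym ?(negbTE oz) ?(negbTE of_).
Qed.

End WitnessSemigroup.

(** * The order on states by inclusion of right languages *)

Section IdealOrder.
Variables (Sigma : finType) (n : nat) (delta : Sigma -> {ffun 'I_n -> 'I_n}).
Variables (z f : 'I_n).
Hypothesis minD : minimal_dfa delta z f.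
Hypothesis idealD : two_sided_ideal (accepts delta z f).

Definition state_le : rel 'I_n :=
  fun p q => `[< forall w, run delta p w = f -> run delta q w = f >].

Lemma state_leP p q :
  reflect (forall w, run delta p w = f -> run delta q w = f) (state_le p q).
Proof. exact: asboolP. Qed.

Lemma state_le_refl : reflexive state_le.
Proof. by move=> p; apply/state_leP. Qed.

Lemma state_le_trans : transitive state_le.
Proof.
by move=> q p r /state_leP pq /state_leP qr; apply/state_leP=> w /pq; exact: qr.
Qed.

Lemma state_le_anti : antisymmetric state_le.
Proof.
move=> p q /andP[/state_leP pq /state_leP qp].
apply: contrapT => /(proj2 minD) [w]; apply; split; [exact: pq | exact: qp].
Qed.

(** Uses the right-ideal property: an accepted word leads to [f] and stays accepted when extended by
    [w]. *)
Lemma run_final w : run delta f w = f.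
Proof.
have [[x Lx] /(_ (x ++ w)) [_ h]] := idealD.
have : accepts delta z f (x ++ w) by apply: h; exists [::], x, w.
by rewrite /accepts run_cat Lx.
Qed.

Lemma state_le_top p : state_le p f.
Proof. by apply/state_leP=> w _; exact: run_final. Qed.

(** Uses the left-ideal property: a word accepted from [z] stays accepted when preceded by a word
    leading to [p]. *)
Lemma state_le_bot p : state_le z p.
Proof.
apply/state_leP=> w Lw; have [u <-] := (proj1 minD) p; rewrite -run_cat.
by apply: (proj2 (proj2 idealD _)); exists u, w, [::]; rewrite cats0.
Qed.

Lemma trans_semigroup_final t : t \in trans_semigroup delta -> t f = f.
Proof. by case/trans_semigroupP=> w [_ <-]; rewrite ffunE run_final. Qed.

Lemma trans_semigroup_mono t :
  t \in trans_semigroup delta -> {homo t : p q / state_le p q}.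
Proof.
case/trans_semigroupP=> w [_ <-] p q /state_leP pq; apply/state_leP=> v.
by rewrite !ffunE -!run_cat; exact: pq.
Qed.

End IdealOrder.

(** * Counting flat transformations, and the conclusion *)

Lemma card_flat_tr n (z f : 'I_n) : z != f ->
  #|[set t | flat_tr z f t]| <= n ^ (n - 2) + (n - 2) * 2 ^ (n - 2) + 1.
Proof.
move=> zf; pose U p := if p == z then [set: 'I_n] else [set p; f].
apply: (@leq_trans (\sum_(p : 'I_n) #|U p| ^ (n - 2))).
  rewrite -sum1_card (partition_big (fun t : {ffun _} => t z) xpredT) //.
  apply: leq_sum => p _; rewrite sum1_card.
  have -> : n - 2 = #|'I_n| - #|[set z; f]| by rewrite card_ord cards2 zf.
  apply: leq_trans (card_maps_fixed_on _ (fun q => if q == z then p else f) _).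
  apply/subset_leq_card/subsetP=> t.
  rewrite !inE => /andP[]; rewrite inE /flat_tr => /andP[/eqP tf tU] /eqP tz.
  apply/andP; split; last by move: tU; rewrite /U tz.
  apply/forall_inP=> q; rewrite !inE; case: (eqVneq q z) => [->|_] /=; rewrite ?tz //.
  by move/eqP->; rewrite tf.
(* The value $p$ at [z] gives the three summands: $n^{n-2}$ for $p=z$, $1$ for $p=f$, and $2^{n-2}$
   for each of the $n-2$ others. *)
rewrite (bigD1 z) //= (bigD1 f) /=; last by rewrite eq_sym.
have -> : U z = setT by rewrite /U eqxx.
have -> : U f = [set f] by rewrite /U eq_sym (negbTE zf) setUid.
rewrite cardsT card_ord cards1 exp1n -addnA leq_add2l addnC leq_add2r.
rewrite (eq_bigr (fun=> 2 ^ (n - 2))) => [|p /andP[pz pf]]; last first.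
  by rewrite /U (negbTE pz) cards2 pf.
rewrite sum_nat_const leq_mul // (eq_card (B := ~: [set z; f])) => [|p]; last first.
  by rewrite !inE negb_or.
by have := cardsC [set z; f]; rewrite cards2 zf card_ord; lia.
Qed.

Theorem theorem5 (n : nat) (Sigma : finType)
    (delta : Sigma -> {ffun 'I_n -> 'I_n}) (i0 f : 'I_n) :
  4 <= n -> val i0 = 0 -> val f = n - 1 ->
  minimal_dfa delta i0 f ->
  two_sided_ideal (accepts delta i0 f) ->
  #|trans_semigroup delta| = n ^ (n - 2) + (n - 2) * 2 ^ (n - 2) + 1 ->
  trans_semigroup delta = S_ n.
Proof.
move=> n4 zE fE minD idealD cardT.
have zf := zNf n4 zE fE.
pose le := state_le delta f.
have [flat|/forallPn[a]] := boolP [forall a, forall b,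
  [&& a != i0, b != f & le a b] ==> (a == b)]; last first.
  case/forallPn=> b; rewrite negb_imply => /andP[/and3P[az bf ab] anb].
  (* A strict comparison $a<b$ excludes $a$ from being the top and $b$ from being the bottom, so
     both are middle states. *)
  have af : a != f.
    apply: contraNneq anb => af; apply/eqP/(state_le_anti minD).
    by apply/andP; split; rewrite // af; exact: state_le_top idealD _.
  have bz : b != i0.
    apply: contraNneq anb => bz; apply/eqP/(state_le_anti minD).
    by apply/andP; split; rewrite // bz; exact: state_le_bot minD idealD _.
  have card4 : #|[set i0; f; a; b]| = 4.
    rewrite setUC cardsU1 (setUC _ [set a]) cardsU1 cards2 !inE eq_sym in anb *.
    by rewrite zf (negbTE az) (negbTE af) (negbTE bz) (negbTE bf) (negbTE anb).
  have := card_monotone_leq (@state_le_refl _ _ delta f) (state_le_anti minD)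
    (@state_le_trans _ _ delta f) (state_le_bot minD idealD)
    (trans_semigroup_final idealD) (@trans_semigroup_mono _ _ delta f) ab card4.
  by rewrite cardT card_ord leqNgt sum_expn_ltn.
rewrite (witness_semigroupE n4 zE fE); apply/eqP.
(* The assumed cardinality bounds $|S_n|$ from above, so inclusion in $S_n$ is enough. *)
rewrite eqEcard cardT card_flat_tr // andbT.
apply/subsetP=> t tT; rewrite inE; apply/flat_trP.
split; first exact: trans_semigroup_final idealD _ tT.
have [tz|tz] := eqVneq (t i0) i0; [by left|right=> q].
(* Monotonicity puts [t q] above [t i0], which is not the bottom; flatness leaves only [t i0] itself
   and [f]. *)
have tzq : le (t i0) (t q).
  exact: trans_semigroup_mono tT _ _ (state_le_bot minD idealD q).
have [|tqf] := eqVneq (t q) f; [by right|left].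
by apply/esym/eqP; have /forallP/(_ (t i0))/forallP/(_ (t q)) := flat; rewrite tz tqf tzq.
Qed.
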